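(* Let $0<p<1$, let $F_n$ be the distribution function of $W(n,p)$, and let $Y\sim W(p)$ (the weaver's hem) be a random variable with distribution function $F=\lim_{n\to\infty}F_n$. Then $F$ is continuous, $EY=p$ and $\sigma^2(Y)=p(1-p)/3$. If $p=1/2$, then $W(n,1/2)$ is a discrete uniform distribution for each $n$ and $W(1/2)$ is the uniform distribution $U(0,1)$, so that $F(x)=x$ for $0<x<1$. If $p\neq 1/2$, then $F$ has no density with respect to Lebesgue measure.
   Context: Weaver's distribution $W(n,p)$ ($n\ge 1$, $0<p<1$): the discrete distribution on the points $y_{k,n}=k/(2^n-1)$, $k=0,\ldots,2^n-1$, with probabilities $p_k=p^{\#1}(1-p)^{\#0}$, where $\#1$ and $\#0$ are the numbers of ones and zeros in the $n$-digit binary representation of $k$. The limit $F=\lim_{n\to\infty}F_n$ is the pointwise limit of the distribution functions; it is a distribution function, and the corresponding distribution is denoted $W(p)$ and called the weaver's hem. $\sigma^2$ denotes variance. *)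

(* Defs.v *)
From HB Require Import structures.
From mathcomp Require Import all_boot all_order all_algebra.
From mathcomp Require Import all_classical all_reals all_analysis.
Import Order.TTheory GRing.Theory Num.Theory.
Import numFieldNormedType.Exports.

Set Implicit Arguments.
Unset Strict Implicit.
Unset Printing Implicit Defensive.

Local Open Scope classical_set_scope.
Local Open Scope ring_scope.

Definition binary_digit (k j : nat) : bool := odd (k %/ 2 ^ j).

Definition ones (n k : nat) : nat := (\sum_(j < n) binary_digit k j)%N.

Definition zeros (n k : nat) : nat := (\sum_(j < n) ~~ binary_digit k j)%N.

Section weaver.
Context {R : realType}.
Implicit Types (n : nat) (p : R).

(* For n = 0 there is the single point 0 / 0 = 0. *)
Definition weaver_point n (k : nat) : R := k%:R / (2 ^+ n - 1).

Definition weaver_pmf n p (k : nat) : R := p ^+ ones n k * (1 - p) ^+ zeros n k.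

Lemma weaver_pmf_ge0 n p k : 0 <= p <= 1 -> 0 <= weaver_pmf n p k.
Proof. by case/andP=> p0 p1; rewrite mulr_ge0 ?exprn_ge0 ?subr_ge0. Qed.

Let binary_digit_low n k j :
  (j < n)%N -> binary_digit (2 ^ n + k) j = binary_digit k j.
Proof.
move=> jn; rewrite /binary_digit -(subnK jn) addnS -addSn expnD.
by rewrite divnMDl ?expn_gt0// oddD oddX.
Qed.

Lemma weaver_pmf_sum n p : \sum_(k < 2 ^ n) weaver_pmf n p k = 1.
Proof.
elim: n => [|n IH].
  by rewrite expn0 big_ord1 /weaver_pmf /ones /zeros !big_ord0 !expr0 mulr1.
have e : (2 ^ n.+1 = 2 ^ n + 2 ^ n)%N by rewrite expnS mul2n addnn.
rewrite e big_split_ord/=.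
under eq_bigr => k _.
  rewrite /weaver_pmf /ones /zeros !big_ord_recr/= -/(ones n k) -/(zeros n k).
  rewrite {1 2}/binary_digit divn_small// addn0 addn1 exprSr mulrA.
  over.
under [X in _ + X]eq_bigr => k _.
  rewrite /weaver_pmf /ones /zeros !big_ord_recr/=.
  under eq_bigr do rewrite binary_digit_low//.
  under [X in (1 - p) ^+ (X + _)]eq_bigr do rewrite binary_digit_low//.
  rewrite -/(ones n k) -/(zeros n k) /binary_digit divnDl ?dvdnn//.
  rewrite divnn expn_gt0/= divn_small//= addn1 addn0 exprS -mulrA.
  over.
by rewrite -mulr_suml -mulr_sumr IH mul1r mulr1 subrK.
Qed.

(* Total in p, as in the library's binomial_prob: outside [0, 1] the value is
   an arbitrary probability measure. *)
Definition weaver_prob n p : set R -> \bar R := fun A =>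
  if 0 <= p <= 1 then
    (\sum_(k < 2 ^ n) (weaver_pmf n p k)%:E * \d_(weaver_point n k) A)%E
  else \d_(0 : R) A.

Section weaver_probability.
Variables (n : nat) (p : R).
Local Open Scope ereal_scope.

Let weaver_prob0 : weaver_prob n p set0 = 0.
Proof.
rewrite /weaver_prob; case: ifPn => _; last by rewrite measure0.
by rewrite big1// => k _; rewrite measure0 mule0.
Qed.

Let weaver_prob_ge0 A : 0 <= weaver_prob n p A.
Proof.
rewrite /weaver_prob; case: ifPn => // p01.
by apply: sume_ge0 => k _; rewrite mule_ge0// lee_fin weaver_pmf_ge0.
Qed.

Let weaver_prob_sigma_additive : semi_sigma_additive (weaver_prob n p).
Proof.
move=> F mF tF mUF; rewrite /weaver_prob; case: ifPn => p01; last first.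
  exact: measure_semi_sigma_additive.
pose m := msum (fun k => mscale (NngNum (weaver_pmf_ge0 n k p01))
                                (dirac (weaver_point n k))) (2 ^ n).
exact: (@measure_semi_sigma_additive _ _ _ m).
Qed.

HB.instance Definition _ := isMeasure.Build _ _ _ (weaver_prob n p)
  weaver_prob0 weaver_prob_ge0 weaver_prob_sigma_additive.

Let weaver_prob_setT : weaver_prob n p [set: _] = 1.
Proof.
rewrite /weaver_prob; case: ifPn => p01; last by rewrite diracT.
under eq_bigr do rewrite diracT mule1.
by rewrite sumEFin weaver_pmf_sum.
Qed.

HB.instance Definition _ :=
  Measure_isProbability.Build _ _ R (weaver_prob n p) weaver_prob_setT.

End weaver_probability.

(* The library's cdf takes a random variable: for Y with law W,
   cdf Y x = W `]-oo, x], which is always finite. *)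
Definition distribution_function (W : probability R R) (x : R) : R :=
  fine (W `]-oo, x]%classic).

Definition weaver_cdf n p : R -> R := distribution_function (weaver_prob n p).

Definition weaver_hem_cdf p (x : R) : R := limn (fun n => weaver_cdf n p x).

Definition is_weaver_hem p (W : probability R R) : Prop :=
  forall x : R, distribution_function W x = weaver_hem_cdf p x.

Definition discrete_uniform_on (s : seq R) (W : probability R R) : Prop :=
  [/\ s != [::], uniq s &
      forall A : set R, measurable A ->
        W A = ((size s)%:R^-1%:E * \sum_(x <- s) \d_x A)%E].

Definition has_density (F : R -> R) : Prop :=
  exists f : R -> R, [/\ measurable_fun [set: R] f, forall x, 0 <= f x &
    forall x, (F x)%:E = (\int[lebesgue_measure]_(t in `]-oo, x]) (f t)%:E)%E].

End weaver.

(* Main.v *)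
Require Import Defs.
From HB Require Import structures.
From mathcomp Require Import all_boot all_order all_algebra.
From mathcomp Require Import all_classical all_reals all_analysis.
From mathcomp Require Import measurable_realfun.
From mathcomp Require Import ring lra.
Import Order.TTheory GRing.Theory Num.Theory.
Import numFieldNormedType.Exports.
Local Open Scope classical_set_scope.
Local Open Scope ring_scope.

Set Implicit Arguments.
Unset Strict Implicit.
Unset Printing Implicit Defensive.

(** Let K be the random integer whose n binary digits are independent and equal
    to 1 with probability p, so that W(n, p) is the law of K / (2 ^ n - 1).
    Scaling by 2 ^ n instead makes the digit structure exact: a new leading digit
    halves K / 2 ^ n and, when it is 1, adds 1/2. Hence the distribution
    functions G_n of K / 2 ^ n satisfy
      G_(n+1) (x) = (1 - p) G_n (2 x) + p G_n (2 x - 1)     [grid_cdfS].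
    They decrease with n, so they converge to some F [hem_cdf], and the limit is
    a nondecreasing solution of
      F (x) = (1 - p) F (2 x) + p F (2 x - 1),   F = 0 below 0,   F = 1 from 1 on
    [hem_cdf_woven]. Everything is deduced from this equation.

    Continuity: a dyadic interval of level n has F-mass a product of n factors p
    or 1 - p, hence at most max (p, 1 - p) ^ n [woven_continuous].

    Convergence: on [0, 1] the two scalings are interleaved,
      G_n (x - 2 ^ -n) <= F_n (x) <= G_n (x)     [weaver_cdf_bounds],
    and both sides tend to F (x) because F is continuous [cvg_weaver_cdf].

    Moments: the law of Y is the mixture, with weights 1 - p and p, of its images
    under x / 2 and (x + 1) / 2 [hem_self_similar]. Integrating x and x ^ 2
    against this identity gives linear equations for the first two moments.

    Case p = 1/2: the identity solves the equation on [0, 1], and the distance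
    of any solution to the identity is halved by each use of the equation
    [woven_half_id].

    Case p <> 1/2: suppose that F has density f. On an interval I of length |I|
    and F-mass F(I), the arithmetic-geometric inequality bounds the integral of
    sqrt f by (c F(I) + |I| / c) / 2, for every c > 0. The halves of a dyadic I
    have masses (1 - p) F(I) and p F(I); bounding each half with its own best c
    improves the bound for I by the factor
      rho = sqrt ((1 - p) / 2) + sqrt (p / 2),
    and rho < 1 because p <> 1/2 [rho_lt1]. Iterating the subdivision of ]0, 1]
    shows that the integral of sqrt f there is at most rho ^ m for every m
    [integral_sqrt_density_dyadic]. So f vanishes almost everywhere on ]0, 1],
    an interval of F-mass 1. *)

(** * Solutions of the weaving equation *)

Section woven.
Context {R : realType}.
Implicit Types (p x y : R) (F : R -> R).

Definition woven p F : Prop :=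
  [/\ {homo F : x y / x <= y}, forall x, x < 0 -> F x = 0,
      forall x, 1 <= x -> F x = 1 &
      forall x, F x = (1 - p) * F (2 * x) + p * F (2 * x - 1)].

Lemma woven_ge0 p F x : woven p F -> 0 <= F x.
Proof.
case=> Fnd F0 _ _; have [x0|x0] := ltP x 0; first by rewrite F0.
by rewrite -(F0 (-1)) ?ltrN10// Fnd// (le_trans _ x0)// lerN10.
Qed.

Lemma woven_le1 p F x : woven p F -> F x <= 1.
Proof.
case=> Fnd _ F1 _; have [x1|x1] := leP 1 x; first by rewrite F1.
by rewrite -(F1 1)// Fnd// ltW.
Qed.

(** At 0 the equation reads F 0 = (1 - p) F 0, so there is no atom at 0. *)
Lemma woven_le0 p F x : 0 < p -> woven p F -> x <= 0 -> F x = 0.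
Proof.
move=> p0 [Fnd F0 _ Fe]; rewrite le_eqVlt => /predU1P[->|/F0//].
have := Fe 0; rewrite mulr0 add0r (F0 (-1)) ?ltrN10// mulr0 addr0 mulrBl mul1r.
move/esym/eqP; rewrite -subr_eq0 addrAC subrr add0r oppr_eq0.
by rewrite mulf_eq0 gt_eqF//= => /eqP.
Qed.

(** The two terms of the equation never vary together: the second one vanishes
    on the left half of the unit interval and the first one is constant on the
    right half. *)
Lemma woven_left p F x : 0 < p -> woven p F -> x <= 1 / 2 ->
  F x = (1 - p) * F (2 * x).
Proof.
move=> p0 Fw x2; have [_ _ _ ->] := Fw.
by rewrite (woven_le0 (x := 2 * x - 1) p0 Fw) ?mulr0 ?addr0//; lra.
Qed.

Lemma woven_right p F x : woven p F -> 1 / 2 <= x ->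
  F x = (1 - p) + p * F (2 * x - 1).
Proof. by move=> [_ _ F1 Fe] x2; rewrite Fe F1 ?mulr1//; lra. Qed.

Definition dyadic n k : R := k%:R / 2 ^+ n.

Lemma dyadicSl n k : 2 * dyadic n.+1 k = dyadic n k.
Proof. by rewrite /dyadic exprS; field; rewrite expf_neq0. Qed.

Lemma dyadicSr n k : 2 * dyadic n.+1 (2 ^ n + k) - 1 = dyadic n k.
Proof.
by rewrite /dyadic natrD natrX exprS; field; rewrite expf_neq0.
Qed.

Lemma dyadicS_double n k : dyadic n.+1 k.*2 = dyadic n k.
Proof. by rewrite /dyadic -mul2n natrM exprS; field; rewrite expf_neq0. Qed.

Lemma dyadic_half n k : (k <= 2 ^ n)%N -> dyadic n.+1 k <= 1 / 2.
Proof.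
move=> k2; rewrite /dyadic exprS ler_pdivrMr ?mulr_gt0 ?exprn_gt0//.
by rewrite mulrA divfK// mul1r -natrX ler_nat.
Qed.

Lemma dyadic_half_le n k : 1 / 2 <= dyadic n.+1 (2 ^ n + k).
Proof.
rewrite /dyadic exprS ler_pdivlMr ?mulr_gt0 ?exprn_gt0//.
by rewrite mulrA divfK// mul1r -natrX ler_nat leq_addr.
Qed.

Definition dyadic_mass F n k : R := F (dyadic n k.+1) - F (dyadic n k).

(** [dyadic_massSl] and [dyadic_massSr] read the leading binary digit of the
    position k of a dyadic interval, 0 for k < 2 ^ n and 1 for 2 ^ n + k;
    [dyadic_mass_double] reads its last digit. *)
Lemma dyadic_massSl p F n k : 0 < p -> woven p F -> (k < 2 ^ n)%N ->
  dyadic_mass F n.+1 k = (1 - p) * dyadic_mass F n k.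
Proof.
move=> p0 Fw kn; rewrite /dyadic_mass.
rewrite (woven_left p0 Fw (dyadic_half kn)).
by rewrite (woven_left p0 Fw (dyadic_half (ltnW kn))) !dyadicSl mulrBr.
Qed.

Lemma dyadic_massSr p F n k : woven p F ->
  dyadic_mass F n.+1 (2 ^ n + k) = p * dyadic_mass F n k.
Proof.
move=> Fw; rewrite /dyadic_mass -addnS.
rewrite (woven_right Fw (dyadic_half_le n k.+1)).
by rewrite (woven_right Fw (dyadic_half_le n k)) !dyadicSr; lra.
Qed.

Lemma dyadic_mass0 p F k : 0 < p -> woven p F ->
  dyadic_mass F 0 k = (k == 0%N)%:R.
Proof.
move=> p0 Fw; have [_ _ F1 _] := Fw.
rewrite /dyadic_mass /dyadic expr0 !divr1 F1 ?ler1n//.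
case: k => [|k]; first by rewrite (woven_le0 p0 Fw)// subr0.
by rewrite F1 ?ler1n// subrr.
Qed.

Lemma dyadic_mass_le p M F n k : 0 < p < 1 -> p <= M -> 1 - p <= M ->
  woven p F -> dyadic_mass F n k <= M ^+ n.
Proof.
move=> /andP[p0 p1] pM qM Fw; have q0 : 0 <= 1 - p by rewrite subr_ge0 ltW.
have D0 m j : 0 <= dyadic_mass F m j.
  have [Fnd _ _ _] := Fw; rewrite subr_ge0 Fnd//.
  by rewrite ler_wpM2r ?invr_ge0 ?exprn_ge0// ler_nat.
elim: n k => [|n IH] k.
  by rewrite (dyadic_mass0 _ p0 Fw) expr0 lern1; case: eqP.
rewrite exprS; have [kn|/subnKC <-] := ltnP k (2 ^ n).
  by rewrite (dyadic_massSl p0 Fw)// ler_pM.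
by rewrite (dyadic_massSr _ _ Fw) ler_pM// ltW.
Qed.

(** Splitting a dyadic interval divides its mass in the ratio 1 - p to p. The
    equation only gives this for the unit interval; the induction transports it
    to smaller intervals, as both sides scale alike when the leading digit is
    removed. *)
Lemma dyadic_mass_double p F n k : 0 < p -> woven p F ->
  dyadic_mass F n.+1 k.*2 = (1 - p) * dyadic_mass F n k /\
  dyadic_mass F n.+1 k.*2.+1 = p * dyadic_mass F n k.
Proof.
move=> p0 Fw; have two_double m : (2 ^ m.+1 = (2 ^ m).*2)%N.
  by rewrite expnS mul2n.
elim: n k => [[|k]|n IH k].
- split; first exact: dyadic_massSl.
  exact: (dyadic_massSr 0 0 Fw).
- rewrite !(dyadic_mass0 _ p0 Fw)/= !mulr0.
  have -> : k.+1.*2 = (2 ^ 0 + k.*2.+1)%N by [].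
  rewrite -addnS !(dyadic_massSr _ _ Fw).
  by rewrite !(dyadic_mass0 _ p0 Fw)/= !mulr0.
- have [kn|/subnKC <-] := ltnP k (2 ^ n).
    rewrite (dyadic_massSl p0 Fw kn).
    rewrite !(dyadic_massSl (n := n.+1) p0 Fw) ?two_double ?ltn_double//; last first.
      by rewrite ltn_Sdouble.
    by have [-> ->] := IH k; split; ring.
  rewrite (dyadic_massSr _ _ Fw).
  rewrite doubleD -two_double -addnS !(dyadic_massSr n.+1 _ Fw).
  by have [-> ->] := IH (k - 2 ^ n)%N; split; ring.
Qed.

(** Two points at distance at most 2 ^ -n lie in the union of two adjacent dyadic
    intervals of level n. *)
Lemma woven_modulus p M F n x y : 0 < p < 1 -> p <= M -> 1 - p <= M ->
  woven p F -> y <= x + 2 ^- n -> F y - F x <= 2 * M ^+ n.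
Proof.
move=> p01 pM qM Fw yx; have [p0 p1] := andP p01; have [Fnd F0 _ _] := Fw.
wlog x0 : x yx / 0 <= x => [wl|].
  have [/wl|x0] := leP 0 x; first exact.
  rewrite (F0 x x0); have := wl 0; rewrite (woven_le0 p0 Fw (lexx 0)); apply => //.
  by rewrite (le_trans yx)// lerD2r ltW.
have t0 : 0 < 2 ^+ n :> R by rewrite exprn_gt0.
set k := Num.truncn (x * 2 ^+ n).
have /andP[kx xk] : k%:R <= x * 2 ^+ n < k.+1%:R.
  by apply: Num.Theory.truncn_itv; rewrite mulr_ge0// ltW.
have Fx : F (dyadic n k) <= F x.
  by rewrite Fnd// /dyadic ler_pdivrMr.
have Fy : F y <= F (dyadic n k.+2).
  rewrite Fnd// (le_trans yx)// /dyadic ler_pdivlMr// mulrDl mulVf ?gt_eqF//.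
  by rewrite -[k.+2]addn1 natrD lerD2r ltW.
have := dyadic_mass_le n k p01 pM qM Fw.
have := dyadic_mass_le n k.+1 p01 pM qM Fw.
rewrite /dyadic_mass; lra.
Qed.

Lemma woven_continuous p F : 0 < p < 1 -> woven p F -> continuous F.
Proof.
move=> p01 Fw x; have [Fnd _ _ _] := Fw; have [p0 p1] := andP p01.
have [M [pM qM M1]] : exists M, [/\ p <= M, 1 - p <= M & M < 1].
  have [pq|qp] := leP p (1 - p); first by exists (1 - p); split => //; lra.
  by exists p; split => //; exact: ltW.
have M0 : 0 <= M by rewrite (le_trans (ltW p0)).
apply/cvgrPdist_le => e e0.
have [n Mn] : exists n, 2 * M ^+ n <= e.
  have /cvgrPdist_le/(_ _ e0)[n _ /(_ n (leqnn n))] :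
    geometric 2 M n @[n --> \oo] --> 0 by apply: cvg_geometric; rewrite ger0_norm.
  rewrite sub0r normrN ger0_norm ?mulr_ge0 ?exprn_ge0//.
  by exists n.
near=> y; rewrite (le_trans _ Mn)// ler_norml.
have yx : `|x - y| <= 2 ^- n.
  near: y; have /cvgrPdist_le : (id : R -> R) @ x --> x by exact: cvg_id.
  by apply; rewrite invr_gt0 exprn_gt0.
move: yx; rewrite ler_norml => /andP[yx1 yx2].
have A := @woven_modulus p M F n y x p01 pM qM Fw.
have B := @woven_modulus p M F n x y p01 pM qM Fw.
apply/andP; split.
  rewrite lerNl opprB; apply: B; lra.
by apply: A; lra.
Unshelve. all: by end_near. Qed.

End woven.

(** * The limit distribution function *)

Section grid.
Context {R : realType}.
Implicit Types (p x y : R).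

Lemma binary_digit_high n k : (k < 2 ^ n)%N -> binary_digit k n = false.
Proof. by move=> kn; rewrite /binary_digit divn_small. Qed.

Lemma binary_digit_addl n k : (k < 2 ^ n)%N -> binary_digit (2 ^ n + k) n.
Proof.
by move=> kn; rewrite /binary_digit divnDl ?dvdnn// divnn expn_gt0/= divn_small.
Qed.

Lemma binary_digit_low n k j : (j < n)%N ->
  binary_digit (2 ^ n + k) j = binary_digit k j.
Proof.
move=> jn; rewrite /binary_digit -(subnK jn) addnS -addSn expnD.
by rewrite divnMDl ?expn_gt0// oddD oddX.
Qed.

(** A leading digit 0 contributes a factor 1 - p and a leading digit 1 a factor
    p. *)
Lemma weaver_pmf_low n p k : (k < 2 ^ n)%N ->
  weaver_pmf n.+1 p k = (1 - p) * weaver_pmf n p k.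
Proof.
move=> kn; rewrite /weaver_pmf /ones /zeros !big_ord_recr/=.
by rewrite binary_digit_high// addn0 addn1 exprS mulrCA.
Qed.

Lemma weaver_pmf_high n p k : (k < 2 ^ n)%N ->
  weaver_pmf n.+1 p (2 ^ n + k) = p * weaver_pmf n p k.
Proof.
move=> kn; rewrite /weaver_pmf /ones /zeros !big_ord_recr/=.
under eq_bigr do rewrite binary_digit_low//.
under [X in (1 - p) ^+ (X + _)]eq_bigr do rewrite binary_digit_low//.
by rewrite binary_digit_addl// addn0 addn1 exprS mulrA.
Qed.

Lemma weaver_pmf_nneg n p k : 0 < p < 1 -> 0 <= weaver_pmf n p k.
Proof. by case/andP=> p0 p1; rewrite weaver_pmf_ge0// !ltW. Qed.

(** The distribution function of the same random integer divided by 2 ^ n, for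
    which prefixing a digit is exactly an affine map. *)
Definition grid_cdf n p x : R :=
  \sum_(k < 2 ^ n) weaver_pmf n p k * (k%:R <= x * 2 ^+ n)%R%:R.

Lemma grid_cdf0 p x : grid_cdf 0 p x = (0 <= x)%R%:R.
Proof.
rewrite /grid_cdf expn0 big_ord1 /weaver_pmf /ones /zeros !big_ord0.
by rewrite !expr0 !mulr1 mul1r.
Qed.

Lemma grid_cdfS n p x :
  grid_cdf n.+1 p x = (1 - p) * grid_cdf n p (2 * x) + p * grid_cdf n p (2 * x - 1).
Proof.
rewrite /grid_cdf (_ : 2 ^ n.+1 = 2 ^ n + 2 ^ n)%N; last first.
  by rewrite expnS mul2n addnn.
rewrite big_split_ord/= !mulr_sumr; congr (_ + _); apply: eq_bigr => k _.
  rewrite weaver_pmf_low// [RHS]mulrA exprS; congr (_ * _).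
  by congr ((nat_of_bool _)%:R); congr (_ <= _); ring.
rewrite weaver_pmf_high// [RHS]mulrA natrD natrX exprS; congr (_ * _).
congr ((nat_of_bool _)%:R).
by rewrite mulrBl mul1r lerBrDl; congr (_ <= _); ring.
Qed.

Lemma grid_cdf_lt0 n p x : x < 0 -> grid_cdf n p x = 0.
Proof.
move=> x0; apply: big1 => k _; rewrite leNgt (_ : _ < _) ?mulr0//.
by rewrite (@lt_le_trans _ _ 0)// pmulr_llt0// exprn_gt0.
Qed.

Lemma grid_cdf_ge1 n p x : 1 <= x -> grid_cdf n p x = 1.
Proof.
move=> x1; rewrite -(weaver_pmf_sum n p); apply: eq_bigr => k _.
rewrite (_ : _ <= _) ?mulr1// (@le_trans _ _ (2 ^+ n))//.
  by rewrite -natrX ler_nat ltnW.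
by rewrite ler_peMl// exprn_ge0.
Qed.

Lemma grid_cdf_nd n p : 0 < p < 1 -> {homo grid_cdf n p : x y / x <= y}.
Proof.
move=> p01 x y xy; apply: ler_sum => k _.
rewrite ler_wpM2l ?weaver_pmf_nneg// ler_nat.
have [kx|//] := boolP (k%:R <= x * 2 ^+ n).
by rewrite (le_trans kx)// ler_wpM2r// exprn_ge0.
Qed.

(** Appending a last digit can only increase the binary fraction. The recursion
    is monotone, so comparing levels 0 and 1 is enough. *)
Lemma grid_cdf_nonincreasing p x : 0 < p < 1 ->
  nonincreasing_seq (fun n => grid_cdf n p x).
Proof.
move=> /andP[p0 p1]; apply/nonincreasing_seqP => n; elim: n x => [|n IH] x.
  rewrite grid_cdfS !grid_cdf0.
  case: (lerP 0 x); case: (lerP 0 (2 * x)); case: (lerP 0 (2 * x - 1)) => *;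
  by rewrite /= ?mulr1 ?mulr0; lra.
by rewrite grid_cdfS [leRHS]grid_cdfS lerD// ler_wpM2l// ?subr_ge0 ltW.
Qed.

Definition hem_cdf p x : R := limn (fun n => grid_cdf n p x).

Lemma cvg_grid_cdf p x : 0 < p < 1 ->
  grid_cdf n p x @[n --> \oo] --> hem_cdf p x.
Proof.
move=> p01; apply: nonincreasing_is_cvgn; first exact: grid_cdf_nonincreasing.
exists 0 => _ [n _ <-].
by apply: sumr_ge0 => k _; rewrite mulr_ge0// weaver_pmf_nneg.
Qed.

Lemma hem_cdf_le_grid n p x : 0 < p < 1 -> hem_cdf p x <= grid_cdf n p x.
Proof.
move=> p01; apply: nonincreasing_cvgn_ge; first exact: grid_cdf_nonincreasing.
by apply/cvg_ex; exists (hem_cdf p x); exact: cvg_grid_cdf.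
Qed.

Lemma hem_cdf_woven p : 0 < p < 1 -> woven p (hem_cdf p).
Proof.
move=> p01; have cvgG x := @cvg_grid_cdf p x p01; split.
- move=> x y xy; apply: (ler_cvg_to (cvgG x) (cvgG y)).
  by near=> n; exact: grid_cdf_nd.
- move=> x x0; apply: cvg_lim => //; rewrite -[X in _ --> X]/(0 : R).
  by under eq_fun do rewrite grid_cdf_lt0//; exact: cvg_cst.
- move=> x x1; apply: cvg_lim => //.
  by under eq_fun do rewrite grid_cdf_ge1//; exact: cvg_cst.
- move=> x; apply: cvg_lim => //; rewrite -cvg_shiftS/=.
  under eq_fun do rewrite grid_cdfS.
  by apply: cvgD; apply: cvgM => //; exact: cvg_cst.
Unshelve. all: by end_near. Qed.

Lemma weaver_cdfE n p x : 0 < p < 1 ->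
  weaver_cdf n p x =
  \sum_(k < 2 ^ n) weaver_pmf n p k * (weaver_point n k <= x)%R%:R.
Proof.
move=> /andP[p0 p1]; rewrite /weaver_cdf /distribution_function/=.
rewrite /weaver_prob !ltW//=.
under eq_bigr do rewrite diracE -EFinM.
rewrite sumEFin/=; apply: eq_bigr => k _; congr (_ * (nat_of_bool _)%:R).
by apply/idP/idP; rewrite inE/= in_itv.
Qed.

Lemma weaver_cdf_lt0 n p x : 0 < p < 1 -> x < 0 -> weaver_cdf n p x = 0.
Proof.
move=> p01 x0; rewrite weaver_cdfE//; apply: big1 => k _.
rewrite leNgt (_ : _ < _) ?mulr0// (lt_le_trans x0)// divr_ge0//.
by rewrite subr_ge0 exprn_ege1// ler1n.
Qed.

Lemma weaver_cdf_ge1 n p x : 0 < p < 1 -> 1 <= x -> weaver_cdf n p x = 1.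
Proof.
move=> p01 x1; rewrite weaver_cdfE// -[RHS](weaver_pmf_sum n p).
apply: eq_bigr => k _; rewrite (_ : _ <= _) ?mulr1// (le_trans _ x1)//.
rewrite /weaver_point; case: n k => [|n] k; first by rewrite expr0 subrr invr0 mulr0.
rewrite ler_pdivrMr ?subr_gt0 ?exprn_egt1// ?ltr1n// mul1r lerBrDr natr1.
by rewrite -natrX ler_nat.
Qed.

(** The two scalings interleave: k <= x (2 ^ n - 1) implies k <= x 2 ^ n, and it
    follows from k <= x 2 ^ n - 1 because x <= 1. *)
Lemma weaver_cdf_bounds n p x : 0 < p < 1 -> 0 <= x <= 1 ->
  grid_cdf n p (x - 2 ^- n) <= weaver_cdf n p x <= grid_cdf n p x.
Proof.
move=> p01 /andP[x0 x1]; have [p0 p1] := andP p01.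
have t0 : 0 < 2 ^+ n :> R by rewrite exprn_gt0.
(* Level 0 is separate: its only point is 0 / 0 = 0. *)
have k0 (k : 'I_(2 ^ 0)) : (k = 0 :> nat)%N by rewrite (ord1 k).
have t1 : n != 0%N -> 0 < 2 ^+ n - 1 :> R.
  by move=> n0; rewrite subr_gt0 exprn_egt1// ltr1n.
rewrite weaver_cdfE//; apply/andP; split; apply: ler_sum => k _;
  rewrite ler_wpM2l ?weaver_pmf_nneg// ler_nat /weaver_point.
- have [kx|//] := boolP (k%:R <= _); rewrite (_ : _ <= _)//.
  have [n0|/t1 {}t1] := eqVneq n 0%N.
    by move: k kx; rewrite n0 => k _; rewrite k0 mul0r.
  rewrite ler_pdivrMr// (le_trans kx)// mulrBl mulVf ?gt_eqF//.
  by rewrite mulrBr mulr1 lerB.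
- have [kx|//] := boolP (_ / _ <= x); rewrite (_ : _ <= _)//.
  have [n0|/t1 {}t1] := eqVneq n 0%N.
    by move: k kx; rewrite n0 => k _; rewrite k0 mulr_ge0// exprn_ge0.
  move: kx; rewrite ler_pdivrMr// => /le_trans; apply.
  by rewrite ler_wpM2l// gerBl.
Qed.

Lemma cvg_weaver_cdf p x : 0 < p < 1 ->
  weaver_cdf n p x @[n --> \oo] --> hem_cdf p x.
Proof.
move=> p01; have Fw := hem_cdf_woven p01; have [_ F0 F1 _] := Fw.
have [x0|x0] := ltP x 0.
  by rewrite F0//; under eq_fun do rewrite weaver_cdf_lt0//; exact: cvg_cst.
have [x1|/ltW x1] := leP 1 x.
  by rewrite F1//; under eq_fun do rewrite weaver_cdf_ge1//; exact: cvg_cst.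
apply: (@squeeze_cvgr _ _ _ _ (fun n => hem_cdf p (x - 2 ^- n)) (fun n => grid_cdf n p x)).
- near=> n; have /andP[lo ->] := weaver_cdf_bounds n p01 (introT andP (conj x0 x1)).
  by rewrite andbT (le_trans _ lo)// hem_cdf_le_grid.
(* The lower bound G_n (x - 2 ^ -n) is replaced by the limit function at the
   same point, where continuity applies. *)
- have xn : (x - 2 ^- n : R) @[n --> \oo] --> x.
    rewrite -[X in _ --> X]subr0; apply: cvgB; first exact: cvg_cst.
    under eq_fun do rewrite -exprVn.
    by apply: cvg_expr; rewrite ger0_norm ?invr_ge0// invf_lt1 ?ltr1n.
  exact: (cvg_comp _ _ xn (@woven_continuous _ p _ p01 Fw x)).
- exact: cvg_grid_cdf.
Unshelve. all: by end_near. Qed.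

Lemma weaver_hem_cdfE p : 0 < p < 1 -> weaver_hem_cdf p = hem_cdf p.
Proof. by move=> p01; apply/funext => x; apply/cvg_lim/cvg_weaver_cdf. Qed.

End grid.

(** * The law with the limit distribution function *)

Section hem_measure.
Context {R : realType}.
Variables (p : R) (p01 : 0 < p < 1).
Local Notation F := (hem_cdf p).

Let F_nd : nondecreasing F.
Proof. by have [] := hem_cdf_woven p01. Qed.

Let F_rc : right_continuous F.
Proof. exact/right_continuousW/(woven_continuous p01)/hem_cdf_woven. Qed.

#[local]
HB.instance Definition _ := isCumulative.Build R _ R F F_nd F_rc.

Let F_Ny0 : F @ -oo --> (0 : R).
Proof.
have [_ F0 _ _] := hem_cdf_woven p01.
apply: cvg_near_cst; near=> x; apply: F0; near: x; exact: nbhs_ninfty_lt.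
Unshelve. all: by end_near. Qed.

Let F_y1 : F @ +oo --> (1 : R).
Proof.
have [_ _ F1 _] := hem_cdf_woven p01.
apply: cvg_near_cst; near=> x; apply: F1; near: x; exact: nbhs_pinfty_ge.
Unshelve. all: by end_near. Qed.

#[local]
HB.instance Definition _ :=
  isCumulativeBounded.Build R 0 1 F F_Ny0 F_y1.

(** The Lebesgue-Stieltjes measure is a measure on [measurableTypeR R]. The real
    line itself carries the same sigma-algebra under another display, and the
    measure structure is rebuilt there. *)
Definition hem_prob : set R -> \bar R := lebesgue_stieltjes_measure F.

Let hem_prob0 : hem_prob set0 = 0%E. Proof. exact: measure0. Qed.

Let hem_prob_ge0 A : (0 <= hem_prob A)%E. Proof. exact: measure_ge0. Qed.

Let hem_prob_sigma_additive : semi_sigma_additive hem_prob.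
Proof.
exact: (@measure_semi_sigma_additive _ _ _ (lebesgue_stieltjes_measure F)).
Qed.

HB.instance Definition _ := isMeasure.Build _ _ _ hem_prob
  hem_prob0 hem_prob_ge0 hem_prob_sigma_additive.

Let hem_prob_setT : hem_prob setT = 1%E.
Proof. exact: (@probability_setT _ _ _ (lebesgue_stieltjes_measure F)). Qed.

HB.instance Definition _ :=
  Measure_isProbability.Build _ _ R hem_prob hem_prob_setT.

Lemma hem_probE x : hem_prob `]-oo, x]%classic = (F x)%:E.
Proof. exact: (cdf_lebesgue_stieltjes_id F x). Qed.

(** The half-open intervals generate the Borel sets, so a measure is known from
    the increments of its distribution function. *)
Lemma lebesgue_stieltjes_hem_prob
    (mu : {measure set (measurableTypeR R) -> \bar R}) :
  (forall a b, a <= b -> mu `]a, b]%classic = (F b - F a)%:E) ->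
  forall A, measurable A -> mu A = hem_prob A.
Proof.
move=> muE A mA; apply/esym/lebesgue_stieltjes_measure_unique => //.
move=> _ [[a b] _ <-]/=; have [ab|ba] := leP a b; last first.
  by rewrite set_itv_ge ?measure0// bnd_simp -leNgt ltW.
rewrite muE// /lebesgue_stieltjes_measure /measure_extension/=.
by rewrite measurable_mu_extE/=; [rewrite wlength_itv_bnd|exact: is_ocitv].
Qed.

End hem_measure.

Section borel_measure.
Context {R : realType} (mu : {measure set R -> \bar R}).

(** The same change of display in the other direction. *)
Definition ocitv_measure : set (measurableTypeR R) -> \bar R := mu.

Let ocitv_measure0 : ocitv_measure set0 = 0%E. Proof. exact: measure0. Qed.

Let ocitv_measure_ge0 A : (0 <= ocitv_measure A)%E.
Proof. exact: measure_ge0. Qed.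

Let ocitv_measure_sigma_additive : semi_sigma_additive ocitv_measure.
Proof. exact: (@measure_semi_sigma_additive _ _ _ mu). Qed.

HB.instance Definition _ := isMeasure.Build _ _ _ ocitv_measure
  ocitv_measure0 ocitv_measure_ge0 ocitv_measure_sigma_additive.

End borel_measure.

Lemma hem_prob_unique (R : realType) (p : R) (p01 : 0 < p < 1)
    (mu : {measure set R -> \bar R}) :
  (forall a b, a <= b -> mu `]a, b]%classic = (hem_cdf p b - hem_cdf p a)%:E) ->
  forall A, measurable A -> mu A = hem_prob p01 A.
Proof. exact: (@lebesgue_stieltjes_hem_prob R p p01 (ocitv_measure mu)). Qed.

Section hem_facts.
Context {R : realType}.
Implicit Types (p : R) (W : probability R R).

Lemma is_weaver_hem_prob p (p01 : 0 < p < 1) : is_weaver_hem p (hem_prob p01).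
Proof.
by move=> x; rewrite weaver_hem_cdfE//; exact: (congr1 fine (hem_probE p01 x)).
Qed.

Lemma is_weaver_hem_itv p W a b : 0 < p < 1 -> is_weaver_hem p W -> a <= b ->
  W `]a, b]%classic = (hem_cdf p b - hem_cdf p a)%:E.
Proof.
move=> p01 WF ab; have WE x : W `]-oo, x]%classic = (hem_cdf p x)%:E.
  have := WF x; rewrite /distribution_function weaver_hem_cdfE// => <-.
  by rewrite fineK// fin_num_measure.
have -> : `]a, b]%classic = `]-oo, b]%classic `\` `]-oo, a]%classic :> set R.
  by rewrite -[RHS]setCK setCD setCitvl setUC -[LHS]setCK setCitv.
rewrite measureD//=; last by rewrite WE ltry.
by rewrite setIidr ?WE ?EFinB//; exact: subset_itvl.
Qed.

End hem_facts.

(** * Self-similarity and moments *)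

Section halves.
Context {R : realType}.

Definition left_half (x : R) : R := x / 2.
Definition right_half (x : R) : R := (x + 1) / 2.

Lemma measurable_left_half : measurable_fun [set: R] left_half.
Proof. exact: measurable_funM. Qed.

Lemma measurable_right_half : measurable_fun [set: R] right_half.
Proof. by apply: measurable_funM => //; exact: measurable_funD. Qed.

HB.instance Definition _ :=
  @isMeasurableFun.Build _ _ R R left_half measurable_left_half.
HB.instance Definition _ :=
  @isMeasurableFun.Build _ _ R R right_half measurable_right_half.

Lemma preimage_left_half (a b : R) :
  left_half @^-1` `]a, b] = `]2 * a, 2 * b]%classic.
Proof.
by apply/seteqP; split=> x /=; rewrite /left_half !in_itv/= => /andP[? ?];
  apply/andP; split; lra.
Qed.

Lemma preimage_right_half (a b : R) :
  right_half @^-1` `]a, b] = `]2 * a - 1, 2 * b - 1]%classic.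
Proof.
by apply/seteqP; split=> x /=; rewrite /right_half !in_itv/= => /andP[? ?];
  apply/andP; split; lra.
Qed.

End halves.

Section moments.
Context {R : realType}.
Variables (p : R) (p01 : 0 < p < 1) (W : probability R R).
Hypothesis Wp : is_weaver_hem p W.

Let p_ge0 : 0 <= p. Proof. by case/andP: p01 => /ltW. Qed.
Let q_ge0 : 0 <= 1 - p. Proof. by case/andP: p01 => _ /ltW; rewrite subr_ge0. Qed.

(** The law of (e + X) / 2 when X has law W and e is an independent digit equal
    to 1 with probability p. *)
Let W' : {measure set R -> \bar R} := measure_add
  (mscale (NngNum q_ge0) (distribution W (left_half : {RV W >-> R})))
  (mscale (NngNum p_ge0) (distribution W (right_half : {RV W >-> R}))).

(** On a half-open interval the two measures agree by the weaving equation. *)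
Lemma hem_self_similar A : measurable A -> W A = W' A.
Proof.
move=> mA; transitivity (hem_prob p01 A).
  apply: hem_prob_unique => // a b; exact: (is_weaver_hem_itv p01 Wp).
apply/esym/hem_prob_unique => // a b ab.
rewrite /W'/= /msum !big_ord_recl big_ord0 adde0/= /mscale/= /distribution /pushforward.
rewrite preimage_left_half preimage_right_half.
have ab2 : 2 * a <= 2 * b by rewrite ler_pM2l.
rewrite !(is_weaver_hem_itv p01 Wp) ?lerD2r//.
have [_ _ _ Fe] := hem_cdf_woven p01.
by rewrite -!EFinM -EFinD [in RHS]Fe [X in _ = (_ - X)%:E]Fe; congr (_%:E); ring.
Qed.

Local Open Scope ereal_scope.

Lemma ge0_integral_hem (f : R -> R) :
  measurable_fun [set: R] f -> (forall x, 0 <= f x)%R ->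
  \int[W]_x (f x)%:E =
  (1 - p)%:E * \int[W]_x (f (x / 2))%:E + p%:E * \int[W]_x (f ((x + 1) / 2))%:E.
Proof.
move=> mf f0; have mEf : measurable_fun [set: R] (EFin \o f).
  exact/measurable_EFinP.
rewrite (eq_measure_integral W'); last by move=> A mA _; exact: hem_self_similar.
rewrite ge0_integral_measure_add//; last by move=> x _; rewrite lee_fin.
rewrite !ge0_integral_mscale//; [|by move=> x _; rewrite lee_fin..].
by rewrite !ge0_integral_distribution//; move=> x; rewrite lee_fin.
Qed.

Lemma hem_ae_unit : {ae W, forall x, (0 <= x <= 1)%R}.
Proof.
have Fw := hem_cdf_woven p01; have [_ F0 F1 _] := Fw.
exists (~` `](0%R : R), 1%R]%classic); split; first exact: measurableC.
- rewrite probability_setC// (is_weaver_hem_itv p01 Wp)//.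
  rewrite F1// (woven_le0 _ Fw)//; last by case/andP: p01.
  by rewrite subr0 subee.
- move=> x; apply: contra_not; rewrite /= in_itv/= => /andP[/ltW -> ->//].
Qed.

(** The law is carried by the unit interval, so x and its absolute value have
    the same integrals; working with nonnegative integrands avoids integrability
    conditions. *)
Lemma eq_integral_hem (f g : R -> R) :
  measurable_fun [set: R] f -> measurable_fun [set: R] g ->
  (forall x, (0 <= x <= 1)%R -> f x = g x) ->
  \int[W]_x (f x)%:E = \int[W]_x (g x)%:E.
Proof.
move=> mf mg fg; apply: ae_eq_integral => //; [exact/measurable_EFinP..|].
by apply: filterS hem_ae_unit => x x01 _; rewrite fg.
Qed.

Lemma integral_hem_le1 (f : R -> R) :
  measurable_fun [set: R] f -> (forall x, 0 <= f x)%R ->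
  (forall x, (0 <= x <= 1)%R -> f x <= 1)%R ->
  exists2 r : R, (0 <= r)%R & \int[W]_x (f x)%:E = r%:E.
Proof.
move=> mf f0 f1; have i0 : 0 <= \int[W]_x (f x)%:E.
  by apply: integral_ge0 => x _; rewrite lee_fin.
have : \int[W]_x (f x)%:E <= 1.
  rewrite -(probability_setT W) -[leRHS]mul1e -integral_cst//.
  apply: ae_ge0_le_integral => //.
  - by move=> x _; rewrite lee_fin.
  - exact/measurable_EFinP.
  - by apply: filterS hem_ae_unit => x x01 _; rewrite lee_fin f1.
case: (\int[W]_x _) i0 => [r| |]//; rewrite lee_fin => r0 _.
by exists r.
Qed.

Let measurable_sqr : measurable_fun [set: R] (fun x : R => x ^+ 2)%R.
Proof. exact: measurable_funX. Qed.

(** The images of x and x ^ 2 under the two halving maps are quadratic polynomials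
    with nonnegative coefficients; their integrals are thus affine in the first
    two moments. *)
Lemma integral_hem_quadratic (r s a b c : R) (h : R -> R) :
  \int[W]_x `|x|%R%:E = r%:E -> \int[W]_x (x ^+ 2)%R%:E = s%:E ->
  (0 <= a)%R -> (0 <= b)%R -> (0 <= c)%R -> measurable_fun [set: R] h ->
  (forall x, (0 <= x <= 1)%R -> h x = a * x + b * x ^+ 2 + c)%R ->
  \int[W]_x (h x)%:E = (a * r + b * s + c)%:E.
Proof.
move=> rE sE a0 b0 c0 mh hE.
have mN : measurable_fun [set: R] (fun x : R => `|x|%:E).
  exact/measurable_EFinP.
have mX : measurable_fun [set: R] (fun x : R => (x ^+ 2)%:E).
  exact/measurable_EFinP.
rewrite (@eq_integral_hem _ (fun x => a * `|x| + b * x ^+ 2 + c)%R)//; last 2 first.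
- apply: measurable_funD => //; apply: measurable_funD; exact: measurable_funM.
- by move=> x x01; rewrite hE// ger0_norm//; case/andP: x01.
under eq_integral do rewrite 2!EFinD 2!EFinM.
have maN := measurable_funeM a%:E mN; have mbX := measurable_funeM b%:E mX.
have aN0 (x : R) : 0 <= a%:E * `|x|%:E by rewrite -EFinM lee_fin mulr_ge0.
have bX0 (x : R) : 0 <= b%:E * (x ^+ 2)%:E.
  by rewrite -EFinM lee_fin mulr_ge0// sqr_ge0.
rewrite !ge0_integralD//; [|by move=> x _; exact: adde_ge0|exact: emeasurable_funD].
rewrite !ge0_integralZl_EFin//; last by move=> x _; rewrite lee_fin sqr_ge0.
rewrite rE sE integral_cst//.
by rewrite [X in _ + _ * X]probability_setT mule1.
Qed.

(** The first moment r satisfies r = (1 - p) r / 2 + p (r + 1) / 2, that is r = p,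
    and the second one s = (1 - p) s / 4 + p (s + 2 r + 1) / 4. *)
Lemma integral_hem_norm_sqr :
  \int[W]_x `|x|%:E = p%:E /\
  \int[W]_x (x ^+ 2)%:E = (p * (1 + 2 * p) / 3)%:E.
Proof.
have [r r0 rE] : exists2 r : R, (0 <= r)%R & \int[W]_x `|x|%R%:E = r%:E.
  by apply: integral_hem_le1 => // x /andP[x0 x1]; rewrite ger0_norm.
have [s s0 sE] : exists2 s : R, (0 <= s)%R & \int[W]_x (x ^+ 2)%R%:E = s%:E.
  apply: integral_hem_le1 => // [x|x /andP[x0 x1]]; first exact: sqr_ge0.
  by rewrite expr_le1.
have quad := integral_hem_quadratic rE sE.
have mleft : measurable_fun [set: R] (fun x : R => x / 2)%R.
  exact: measurable_left_half.
have mright : measurable_fun [set: R] (fun x : R => (x + 1) / 2)%R.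
  exact: measurable_right_half.
have rp : r = p.
  have := ge0_integral_hem (@normr_measurable R setT) (fun x => normr_ge0 x).
  rewrite rE (quad (2^-1) 0 0)%R//; last 2 first.
  - exact: measurableT_comp.
  - by move=> x /andP[x0 x1]; rewrite ger0_norm ?divr_ge0//; lra.
  rewrite (quad (2^-1) 0 (2^-1))%R//; last 2 first.
  - exact: measurableT_comp.
  - by move=> x /andP[x0 x1]; rewrite ger0_norm ?divr_ge0 ?addr_ge0//; lra.
  by move=> -[]; lra.
split; first by rewrite rE rp.
have := ge0_integral_hem measurable_sqr (fun x => sqr_ge0 x).
rewrite sE (quad 0 (4^-1) 0)%R//; last 2 first.
- exact: measurable_funX.
- by move=> x _; field.
rewrite (quad (2^-1) (4^-1) (4^-1))%R//; last 2 first.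
- exact: measurable_funX.
- by move=> x _; field.
by rewrite rp => -[sp]; congr (_%:E); lra.
Qed.

Lemma integral_hem_variance :
  \int[W]_x ((x - p) ^+ 2)%:E = (p * (1 - p) / 3)%:E.
Proof.
have [rE sE] := integral_hem_norm_sqr.
have mV : measurable_fun [set: R] (fun x : R => (x - p) ^+ 2)%R.
  by apply: measurable_funX; exact: measurable_funB.
have mN : measurable_fun [set: R] (fun x : R => 2 * p * `|x|)%R.
  exact: measurable_funM.
(* The term 2 p x is moved to the left to keep all the integrands
   nonnegative. *)
have : \int[W]_x ((x - p) ^+ 2 + 2 * p * `|x|)%:E =
       (0 * p + 1 * (p * (1 + 2 * p) / 3) + p ^+ 2)%:E.
  apply: (integral_hem_quadratic rE sE) => //; first exact: sqr_ge0.
    exact: measurable_funD.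
  by move=> x /andP[x0 x1]; rewrite ger0_norm//; ring.
under eq_integral do rewrite EFinD.
rewrite ge0_integralD//; last 4 first.
- by move=> x _; rewrite lee_fin sqr_ge0.
- exact/measurable_EFinP.
- by move=> x _; rewrite lee_fin !mulr_ge0.
- exact/measurable_EFinP.
under [X in _ + X]eq_integral do rewrite EFinM.
have p2 : (0 <= 2 * p)%R by rewrite mulr_ge0.
rewrite ge0_integralZl_EFin//; last exact/measurable_EFinP.
rewrite rE -EFinM => /(congr1 (fun z => z - (2 * p * p)%:E)).
by rewrite addeK//= => ->; congr (_%:E); field.
Qed.

End moments.

Lemma weaver_hem_moments (R : realType) (p : R) (d : measure_display)
    (T : measurableType d) (P : probability T R) (Y : {RV P >-> R}) :
  0 < p < 1 -> is_weaver_hem p (distribution P Y) ->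
  ('E_P[Y] = p%:E /\ 'V_P[Y] = (p * (1 - p) / 3)%R%:E)%E.
Proof.
move=> p01 Yp; have EY : 'E_P[Y]%E = p%:E.
  have [pE _] := integral_hem_norm_sqr p01 Yp.
  have mN : measurable_fun [set: R] (fun x : R => `|x|%:E).
    by apply/measurable_EFinP; exact: normr_measurable.
  rewrite unlock -[RHS]pE ge0_integral_distribution//.
  apply: ae_eq_integral => //.
  - exact/measurable_EFinP.
  - exact: measurableT_comp.
  have [N [measN N0 subN]] := hem_ae_unit p01 Yp.
  exists (Y @^-1` N); split => //; first exact: measurable_funPTI.
  move=> x /= h; apply: subN => /= /andP[Y0 Y1]; apply: h => _.
  by rewrite /= ger0_norm.
split => //; rewrite /variance unlock EY/=.
rewrite -(integral_hem_variance p01 Yp) ge0_integral_distribution//; last 2 first.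
- by apply/measurable_EFinP/measurable_funX; exact: measurable_funB.
- by move=> y; rewrite lee_fin sqr_ge0.
by rewrite unlock.
Qed.

(** * The case p = 1/2 *)

Section half.
Context {R : realType}.
Implicit Types (x a b : R).

Lemma le0_geometric (z a : R) : 0 <= z < 1 -> (forall n, a <= z ^+ n) -> a <= 0.
Proof.
move=> /andP[z0 z1] az; have zc : (z ^+ n : R) @[n --> \oo] --> (0 : R).
  by apply: cvg_expr; rewrite ger0_norm.
by apply: (ler_cvg_to (cvg_cst a) zc); near=> n; exact: az.
Unshelve. all: by end_near. Qed.

(** On each half of the unit interval the deviation F y - y is one half of the
    deviation at 2 y or 2 y - 1, so it is bounded by every power of 1/2. *)
Lemma woven_half_id (F : R -> R) x : woven (1 / 2) F -> 0 <= x <= 1 -> F x = x.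
Proof.
move=> Fw x01; have h0 : 0 < 1 / 2 :> R by rewrite divr_gt0.
suff Fx n y : 0 <= y <= 1 -> `|F y - y| <= (1 / 2) ^+ n.
  apply/eqP; rewrite -subr_eq0 -normr_le0 (@le0_geometric (1 / 2))//; last first.
    by move=> n; exact: Fx.
  by apply/andP; split; lra.
elim: n y => [|n IH] y /andP[y0 y1].
  have := woven_ge0 y Fw; have := woven_le1 y Fw.
  by rewrite ler_norml expr0; lra.
have [y2|/ltW y2] := leP y (1 / 2).
  rewrite (woven_left h0 Fw y2) exprS.
  rewrite (_ : _ - y = 1 / 2 * (F (2 * y) - 2 * y)); last by field.
  by rewrite normrM gtr0_norm// ler_pM2l// IH//; apply/andP; split; lra.
rewrite (woven_right Fw y2) exprS.
rewrite (_ : _ - y = 1 / 2 * (F (2 * y - 1) - (2 * y - 1))); last by field.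
by rewrite normrM gtr0_norm// ler_pM2l// IH//; apply/andP; split; lra.
Qed.

Lemma hem_cdf_half x :
  hem_cdf (1 / 2) x = if x <= 0 then 0 else if 1 <= x then 1 else x.
Proof.
have h01 : 0 < (1 / 2 : R) < 1 by apply/andP; split; lra.
have Fw := hem_cdf_woven h01; have [_ _ F1 _] := Fw; have [h0 _] := andP h01.
case: (lerP x 0) => x0; first by rewrite (woven_le0 h0 Fw).
case: (lerP 1 x) => x1; first by rewrite F1.
by rewrite (woven_half_id Fw)// !ltW.
Qed.

(** The increments of the uniform distribution function are the lengths of the
    traces ]a, b] /\ [0, 1]; the cases sort out whether this trace is empty,
    closed at 0 or open at a. *)
Lemma uniform_prob_itv a b : a <= b ->
  uniform_prob (@ltr01 R) `]a, b]%classic =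
  (hem_cdf (1 / 2) b - hem_cdf (1 / 2) a)%:E.
Proof.
move=> ab; rewrite /uniform_prob integral_uniform_pdf.
rewrite (eq_integral (cst 1%:E)); last first.
  move=> x; rewrite inE => -[_]; rewrite /= in_itv/= /uniform_pdf => ->.
  by rewrite subr0 invr1.
rewrite integral_cst//; last exact: measurableI.
rewrite mul1e !hem_cdf_half.
have [b0|b0] := ltP b 0.
  rewrite (ltW b0) (le_trans ab (ltW b0)) subrr (_ : _ `&` _ = set0) ?measure0//.
  by apply/seteqP; split=> x //= []; rewrite !in_itv/= => /andP[? ?] /andP[? ?]; lra.
have [a1|a1] := leP 1 a.
  have b1 := le_trans a1 ab.
  rewrite b1 !leNgt (lt_le_trans ltr01 a1) (lt_le_trans ltr01 b1)/= subrr.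
  rewrite (_ : _ `&` _ = set0) ?measure0//.
  by apply/seteqP; split=> x //= []; rewrite !in_itv/= => /andP[? ?] /andP[? ?]; lra.
(* c is the right end min (b, 1) of the trace. *)
pose c := if 1 <= b then 1 else b.
have cE x : x <= c = (x <= b) && (x <= 1).
  rewrite /c; case: (lerP 1 b) => b1.
    by apply/idP/andP => [x1|[]//]; split=> //; exact: le_trans b1.
  by apply/idP/andP => [xb|[]//]; split=> //; rewrite ltW// (le_lt_trans xb).
have -> : (if b <= 0 then 0 else if 1 <= b then 1 else b) = c.
  rewrite /c; case: (lerP b 0) => // b0'; have -> : b = 0 by apply/le_anti/andP.
  by rewrite ler10.
have c0 : 0 <= c by rewrite cE b0/=.
have [a0|a0] := ltP a 0.
  rewrite (ltW a0) subr0 (_ : _ `&` _ = `[0, c]%classic).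
    rewrite /= lebesgue_measure_itv/= lte_fin; case: ltP => [_|c1].
      by rewrite oppr0 adde0.
    by have -> : c = 0 by apply/le_anti; rewrite c0 c1.
  apply/seteqP; split=> x /=; rewrite !in_itv/= cE.
    by move=> [/andP[_ ->] /andP[-> ->]].
  by move=> /and3P[x0 xb x1]; rewrite xb x0 x1 (lt_le_trans a0).
have ac : a <= c by rewrite cE ab ltW.
have -> : (if a <= 0 then 0 else a) = a.
  by case: (lerP a 0) => // a1'; apply/le_anti; rewrite a0 a1'.
rewrite (_ : _ `&` _ = `]a, c]%classic).
  rewrite /= lebesgue_measure_itv/= lte_fin; case: ltP => [_|c1].
    by rewrite EFinB.
  by have -> : c = a; [apply/le_anti; rewrite ac c1|rewrite subrr].
apply/seteqP; split=> x /=; rewrite !in_itv/= cE.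
  by move=> [/andP[-> ->] /andP[_ ->]].
by move=> /and3P[ax xb x1]; rewrite xb ax x1 ltW// (le_lt_trans a0).
Qed.

Lemma weaver_hem_uniform (W : probability R R) :
  is_weaver_hem (1 / 2) W ->
  forall A, measurable A -> W A = uniform_prob (@ltr01 R) A.
Proof.
have h01 : 0 < (1 / 2 : R) < 1 by apply/andP; split; lra.
move=> Wh A mA; transitivity (hem_prob h01 A).
  by apply: hem_prob_unique => // a b; exact: (is_weaver_hem_itv h01 Wh).
apply/esym; apply: (lebesgue_stieltjes_hem_prob h01 _ mA) => a b.
exact: uniform_prob_itv.
Qed.

Lemma weaver_pmf_half n k : weaver_pmf n (1 / 2 : R) k = (1 / 2) ^+ n.
Proof.
rewrite /weaver_pmf (_ : 1 - 1 / 2 = 1 / 2); last by field.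
rewrite -exprD /ones /zeros -big_split/=; congr (_ ^+ _).
under eq_bigr do rewrite addnC addn_negb.
by rewrite sum1_card card_ord.
Qed.

Lemma weaver_point_inj n : (1 <= n)%N -> injective (@weaver_point R n).
Proof.
move=> n1 j k /mulIf jk; apply/eqP; rewrite -(eqr_nat R); apply/eqP/jk.
by rewrite invr_eq0 subr_eq0 gt_eqF// exprn_egt1 ?ltr1n// -lt0n.
Qed.

Lemma weaver_prob_half_uniform n : (1 <= n)%N ->
  discrete_uniform_on [seq weaver_point n k | k <- iota 0 (2 ^ n)]
    (weaver_prob n (1 / 2 : R)).
Proof.
move=> n1; have h01 : 0 <= (1 / 2 : R) <= 1 by apply/andP; split; lra.
split.
- by rewrite -size_eq0 size_map size_iota expn_eq0.
- by rewrite map_inj_uniq ?iota_uniq//; exact: weaver_point_inj.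
- move=> A mA; rewrite /= /weaver_prob h01 size_map size_iota big_map.
  rewrite (_ : iota 0 (2 ^ n) = index_iota 0 (2 ^ n)); last by rewrite /index_iota subn0.
  rewrite big_mkord ge0_sume_distrr//.
  apply: eq_bigr => k _; rewrite weaver_pmf_half natrX.
  by rewrite div1r exprVn.
Qed.

End half.

(** * Absence of a density for p <> 1/2 *)

Section no_density.
Context {R : realType}.
Local Notation mu := (@lebesgue_measure R).

Lemma ge0_integral_itv_bndoc (g : R -> R) (x : itv_bound R) (a b : R) :
  measurable_fun [set: R] g -> (forall t, 0 <= g t) ->
  (x <= BRight a)%O -> a <= b ->
  (\int[mu]_(t in [set` Interval x (BRight b)]) (g t)%:E =
   \int[mu]_(t in [set` Interval x (BRight a)]) (g t)%:E +
   \int[mu]_(t in `]a, b]) (g t)%:E)%E.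
Proof.
move=> mg g0 xa ab; rewrite (@itv_bndbnd_setU _ _ _ (BRight a))//.
rewrite ge0_integral_setU//.
- by apply: measurable_funTS; exact/measurable_EFinP.
- by move=> t _; rewrite lee_fin.
- apply/disj_setPS => t [/=]; rewrite !itv_boundlr => /andP[_ ta] /andP[at' _].
  by move: ta at'; rewrite !bnd_simp; lra.
Qed.

Variables (p : R) (p01 : 0 < p < 1) (f : R -> R).
Local Notation F := (hem_cdf p).
Hypothesis mf : measurable_fun [set: R] f.
Hypothesis f0 : forall x, 0 <= f x.
Hypothesis fF : forall x, (F x)%:E = (\int[mu]_(t in `]-oo, x]) (f t)%:E)%E.

Local Notation sf := (fun t : R => Num.sqrt (f t)).
Local Notation rho := (Num.sqrt ((1 - p) / 2) + Num.sqrt (p / 2)).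

Lemma density_itv a b : a <= b ->
  (\int[mu]_(t in `]a, b]) (f t)%:E = (F b - F a)%:E)%E.
Proof.
move=> ab; have := fF b; rewrite (ge0_integral_itv_bndoc mf f0 _ ab)//.
rewrite -fF EFinB => ->; by rewrite addeAC subee// add0e.
Qed.

Lemma measurable_sqrt_density : measurable_fun [set: R] sf.
Proof.
apply: measurableT_comp => //; apply: continuous_measurable_fun.
exact: sqrt_continuous.
Qed.

(** The geometric mean of c y and 1 / c is at most their arithmetic mean. *)
Lemma sqrt_AMGM (c y : R) : 0 < c -> 0 <= y ->
  Num.sqrt y <= c / 2 * y + (2 * c)^-1.
Proof.
move=> c0 y0; rewrite -{2}(sqr_sqrtr y0); set s := Num.sqrt y.
rewrite -subr_ge0 (_ : _ - _ = (c * s - 1) ^+ 2 / (2 * c)); last first.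
  by field; rewrite gt_eqF.
by rewrite divr_ge0 ?sqr_ge0// mulr_ge0// ltW.
Qed.

(** Optimizing c would give the Cauchy-Schwarz bound, the square root of
    F(I) |I|; keeping c free spares the case of an interval of mass 0. *)
Lemma integral_sqrt_density_AMGM (c a b : R) : 0 < c -> a <= b ->
  (\int[mu]_(t in `]a, b]) (sf t)%:E <=
   ((c * (F b - F a) + (b - a) / c) / 2)%:E)%E.
Proof.
move=> c0 ab; have c2 : 0 <= c / 2 by rewrite divr_ge0// ltW.
have mfE : measurable_fun `]a, b] (EFin \o f).
  by apply: measurable_funTS; exact/measurable_EFinP.
have i0 : 0 <= (2 * c)^-1 by rewrite invr_ge0 mulr_ge0// ltW.
apply: (@le_trans _ _
  (\int[mu]_(t in `]a, b]) ((c / 2)%:E * (f t)%:E + ((2 * c)^-1)%:E))%E).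
  have mfc : measurable_fun `]a, b] (fun t => (c / 2)%:E * (f t)%:E)%E.
    exact: measurable_funeM.
  have mfs : measurable_fun `]a, b] (EFin \o sf).
    apply: measurable_funTS; apply/measurable_EFinP.
    exact measurable_sqrt_density.
  apply: ge0_le_integral => //.
  - exact: emeasurable_funD.
  - by move=> t _; rewrite -EFinM -EFinD lee_fin sqrt_AMGM.
rewrite ge0_integralD//=; last 2 first.
- by move=> t _; rewrite -EFinM lee_fin mulr_ge0.
- by apply: measurable_funeM.
rewrite ge0_integralZl_EFin//; last by move=> t _; rewrite lee_fin.
rewrite density_itv// integral_cst//= lebesgue_measure_itv/= lte_fin.
have -> : (if a < b then (b%:E + (- a)%:E)%E else 0%E) = (b - a)%:E.
  case: ltP => // ba; have -> : a = b by apply/le_anti/andP.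
  by rewrite subrr.
by rewrite -!EFinM -EFinD lee_fin le_eqVlt; apply/orP; left; apply/eqP; field; rewrite gt_eqF.
Qed.

(** Each subdivision gains a factor rho. The induction is on the number m of
    subdivisions, for all dyadic intervals and all c at once, since the two halves
    are bounded with different values of c. *)
Lemma integral_sqrt_density_dyadic m n k (c : R) : 0 < c ->
  (\int[mu]_(t in `]dyadic n k, dyadic n k.+1]) (sf t)%:E <=
   (rho ^+ m * ((c * dyadic_mass F n k + 2 ^- n / c) / 2))%:E)%E.
Proof.
have dS i j : dyadic i j.+1 - dyadic i j = 2 ^- i :> R.
  by rewrite /dyadic -natr1 mulrDl mul1r addrAC subrr add0r.
have d_le i j : dyadic i j <= dyadic i j.+1 :> R.
  by rewrite -subr_ge0 dS invr_ge0 exprn_ge0.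
elim: m n k c => [|m IH] n k c c0.
  rewrite expr0 mul1r (le_trans (integral_sqrt_density_AMGM c0 (d_le n k)))//.
  by rewrite dS.
have [p0 p1] := andP p01; have Fw := hem_cdf_woven p01.
set s0 := Num.sqrt ((1 - p) / 2); set s1 := Num.sqrt (p / 2).
have s0_gt0 : 0 < s0 by rewrite sqrtr_gt0 divr_gt0// subr_gt0.
have s1_gt0 : 0 < s1 by rewrite sqrtr_gt0 divr_gt0.
have s0E : 1 - p = 2 * s0 ^+ 2.
  by rewrite sqr_sqrtr ?divr_ge0 ?subr_ge0 ?ltW//; field.
have s1E : p = 2 * s1 ^+ 2 by rewrite sqr_sqrtr ?divr_ge0 ?ltW//; field.
rewrite -[dyadic n k]dyadicS_double -[dyadic n k.+1]dyadicS_double doubleS.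
rewrite (ge0_integral_itv_bndoc (a := dyadic n.+1 k.*2.+1)
  measurable_sqrt_density) ?bnd_simp//.
(* For a half of mass 2 s ^ 2 D and length |I| / 2, the choice c / (2 s)
   multiplies both terms of the bound by the same factor s. *)
have c00 : 0 < c / (2 * s0) by rewrite divr_gt0 ?mulr_gt0.
have c10 : 0 < c / (2 * s1) by rewrite divr_gt0 ?mulr_gt0.
apply: (le_trans (leeD (IH n.+1 k.*2 _ c00) (IH n.+1 k.*2.+1 _ c10))).
have [-> ->] := dyadic_mass_double n k p0 Fw.
rewrite -EFinD lee_fin !exprS -/s0 -/s1 le_eqVlt; apply/orP; left; apply/eqP.
set D := dyadic_mass F n k; rewrite s0E {1}s1E.
by field; rewrite !lt0r_neq0 ?exprn_gt0.
Qed.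

(** The squares of the two terms of rho add up to 1/2, so 1 - rho ^ 2 is the
    square of their difference, which is 0 only for p = 1 - p. *)
Lemma rho_lt1 : p != 1 / 2 -> 0 <= rho < 1.
Proof.
move=> p2; have [p0 p1] := andP p01.
set s0 := Num.sqrt _; set s1 := Num.sqrt _.
have s0E : s0 ^+ 2 = (1 - p) / 2.
  by rewrite sqr_sqrtr// divr_ge0// subr_ge0 ltW.
have s1E : s1 ^+ 2 = p / 2 by rewrite sqr_sqrtr// divr_ge0// ltW.
have r0 : 0 <= s0 + s1 by rewrite addr_ge0// sqrtr_ge0.
rewrite r0 -[_ < 1]ltr_sqr ?nnegrE// expr1n -subr_gt0.
have -> : 1 - (s0 + s1) ^+ 2 = (s0 - s1) ^+ 2.
  by rewrite sqrrD sqrrB s0E s1E; field.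
rewrite lt0r sqr_ge0 andbT sqrf_eq0; apply: contra_neq p2 => /eqP.
rewrite subr_eq0 => /eqP s01; move: s0E; rewrite s01 s1E; lra.
Qed.

Lemma hem_density_false : p != 1 / 2 -> False.
Proof.
move=> p2; have [p0 p1] := andP p01; have rho01 := rho_lt1 p2.
have d0 : dyadic 0 0 = 0 :> R by rewrite /dyadic mul0r.
have d1 : dyadic 0 1 = 1 :> R by rewrite /dyadic expr0 divr1.
have Fw := hem_cdf_woven p01.
have I_le m : (\int[mu]_(t in `]0%R, 1%R]) (sf t)%:E <= (rho ^+ m)%:E)%E.
  have := integral_sqrt_density_dyadic m 0 0 ltr01.
  rewrite d0 d1 (dyadic_mass0 _ p0 Fw) expr0 invr1 !mulr1.
  by rewrite (_ : (1 + 1) / 2 = 1) ?mulr1//; field.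
have I_ge0 : (0 <= \int[mu]_(t in `]0%R, 1%R]) (sf t)%:E)%E.
  by apply: integral_ge0 => t _; rewrite lee_fin sqrtr_ge0.
have I0 : (\int[mu]_(t in `]0%R, 1%R]) (sf t)%:E = 0)%E.
  have := I_le 0; move: I_le I_ge0; case: (integral _ _ _) => [r| |]//.
  move=> r_le; rewrite lee_fin => r0 _; congr (_%:E); apply/le_anti.
  by rewrite r0 (le0_geometric rho01)// => n; have := r_le n; rewrite lee_fin.
have msE : measurable_fun (`]0%R, 1%R] : set R) (EFin \o sf).
  apply: measurable_funTS; apply/measurable_EFinP.
  exact measurable_sqrt_density.
have f_ae0 : ae_eq mu `]0%R, 1%R]%classic (EFin \o f) (cst 0%E).
  have : ae_eq mu `]0%R, 1%R]%classic (EFin \o sf) (cst 0%E).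
    apply/(ae_eq_integral_abs mu) => //; rewrite -[RHS]I0.
    by apply: eq_integral => t _ /=; rewrite ger0_norm// sqrtr_ge0.
  apply: filterS => t /[apply] /= -[/eqP].
  rewrite sqrtr_eq0 => ft0; congr (_%:E); apply/le_anti.
  by rewrite ft0 f0.
have := density_itv ler01.
rewrite (@ae_eq_integral _ _ _ _ _ (cst 0%E))//; last first.
  by apply: measurable_funTS; exact/measurable_EFinP.
rewrite integral0 (woven_le0 p0 Fw (lexx 0)); have [_ _ F1 _] := Fw.
by rewrite F1// subr0 => -[/esym/eqP]; rewrite oner_eq0.
Qed.

End no_density.

Lemma hem_cdf_no_density (R : realType) (p : R) : 0 < p < 1 -> p <> 1 / 2 ->
  ~ has_density (hem_cdf p).
Proof.
by move=> p01 /eqP p2 [f [mf f0 fF]]; exact: (hem_density_false p01 mf f0 fF p2).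
Qed.

Theorem theorem10 (R : realType) (p : R) (hp : 0 < p < 1) :
  (forall x : R, weaver_cdf n p x @[n --> \oo] --> weaver_hem_cdf p x) /\
  (exists W : probability R R, is_weaver_hem p W) /\
  continuous (weaver_hem_cdf p) /\
  (forall (d : measure_display) (T : measurableType d) (P : probability T R)
      (Y : {RV P >-> R}), is_weaver_hem p (distribution P Y) ->
    ('E_P[Y] = p%:E)%E /\ ('V_P[Y] = (p * (1 - p) / 3)%R%:E)%E) /\
  (p = 1 / 2 ->
    (forall n : nat, (1 <= n)%N ->
      discrete_uniform_on [seq weaver_point n k | k <- iota 0 (2 ^ n)]
        (weaver_prob n p)) /\
    (forall W : probability R R, is_weaver_hem p W ->
      forall A : set R, measurable A -> W A = uniform_prob (@ltr01 R) A) /\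
    (forall x : R, 0 < x < 1 -> weaver_hem_cdf p x = x)) /\
  (p <> 1 / 2 -> ~ has_density (weaver_hem_cdf p)).
Proof.
have FE := weaver_hem_cdfE hp; have Fw := hem_cdf_woven hp.
split; first by move=> x; rewrite FE; exact: cvg_weaver_cdf.
split; first by exists (hem_prob hp); exact: is_weaver_hem_prob.
split; first by rewrite FE; exact: woven_continuous hp Fw.
split; first by move=> d T P Y; exact: weaver_hem_moments.
split; last by rewrite FE; exact: hem_cdf_no_density.
move=> p2; split; first by move=> n; rewrite p2; exact: weaver_prob_half_uniform.
split; first by rewrite p2; exact: weaver_hem_uniform.
move=> x /andP[/ltW x0 /ltW x1]; rewrite FE; move: Fw; rewrite p2 => Fw.
by rewrite (woven_half_id Fw)// x0 x1.
Qed.
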